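(* Let $X$ be an Hadamard space with dual space $X^*$, $A\colon X\to 2^{X^*}$ a monotone operator satisfying a range condition, $J_A$ the resolvent of $A$, $\{\alpha_n\}$ a sequence in $(0,1]$ such that $\sum_{n=1}^{\infty}\alpha_n=\infty$, and $\{x_n\}$ a sequence defined by $x_1\in X$ and \[ x_{n+1}=(1-\alpha_n)x_n\oplus\alpha_n J_A x_n \] for all $n\in\mathbb{N}$. Then the following hold. (i) The set $A^{-1}(0)$ is nonempty if and only if $\{x_n\}$ is bounded; (ii) if $A^{-1}(0)$ is nonempty and $\inf_n\alpha_n(1-\alpha_n)>0$, then $\{x_n\}$ is $\Delta$-convergent to an element of $A^{-1}(0)$.
   Context: $\mathbb{N}$ is the set of positive integers. Hadamard spaces: A metric space $(X,d)$ is uniquely geodesic if for all $x,y\in X$ there is a unique mapping $\gamma\colon[0,l]\to X$, $l=d(x,y)$, with $\gamma(0)=x$, $\gamma(l)=y$ and $d(\gamma(s),\gamma(t))=|s-t|$ for all $s,t\in[0,l]$; the point $\gamma(\alpha l)$ is denoted by $(1-\alpha)x\oplus\alpha y$ for $\alpha\in[0,1]$. A $\mathrm{CAT}(0)$ space is a uniquely geodesic metric space such that $d((1-\alpha)x\oplus\alpha y,(1-\beta)x\oplus\beta z)\leq |(1-\alpha)\bar x+\alpha\bar y-((1-\beta)\bar x+\beta\bar z)|_{\mathbb{R}^2}$ whenever $x,y,z\in X$, $\alpha,\beta\in[0,1]$ and $\bar x,\bar y,\bar z\in\mathbb{R}^2$ satisfy $d(x,y)=|\bar x-\bar y|_{\mathbb{R}^2}$,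 $d(y,z)=|\bar y-\bar z|_{\mathbb{R}^2}$, $d(z,x)=|\bar z-\bar x|_{\mathbb{R}^2}$ (Euclidean norm). An Hadamard space is a complete $\mathrm{CAT}(0)$ space. $\Delta$-convergence: The asymptotic center of a sequence $\{x_n\}$ in $X$ is $\mathcal{A}(\{x_n\})=\{u\in X : \limsup_n d(u,x_n)=\inf_{y\in X}\limsup_n d(y,x_n)\}$, upper limits being taken in $[0,\infty]$. The sequence $\{x_n\}$ is $\Delta$-convergent to $p\in X$ if $\mathcal{A}(\{x_{n_i}\})=\{p\}$ for each subsequence $\{x_{n_i}\}$ of $\{x_n\}$. Dual space: An element $(x,y)\in X^2$ is written $\overrightarrow{xy}$. The quasilinearization is $\langle \overrightarrow{xy},\overrightarrow{zw}\rangle=\frac12\left(d(x,w)^2+d(y,z)^2-d(x,z)^2-d(y,w)^2\right)$. Write $\alpha\overrightarrow{xy}$ for $(\alpha,\overrightarrow{xy})\in\mathbb{R}\times X^2$ and $\overrightarrow{xy}$ for $1\overrightarrow{xy}$. Define an equivalence relation on $\mathbb{R}\times X^2$ by $\alpha\overrightarrow{xy}\sim\beta\overrightarrow{zw}$ if and only if $\alpha\langle\overrightarrow{xy},\overrightarrow{pq}\rangle=\beta\langle\overrightarrow{zw},\overrightarrow{pq}\rangle$ for all $p,q\in X$. The dual space $X^*$ is the set of equivalence classes $[\alpha\overrightarrow{xy}]$; its origin is $0=[\overrightarrow{aa}]$ for a fixed $a\in X$ (independent of $a$). For $u^*=[\alpha\overrightarrow{xy}]\in X^*$ and $\overrightarrow{pq}\in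 X^2$ put $\langle u^*,\overrightarrow{pq}\rangle=\alpha\langle\overrightarrow{xy},\overrightarrow{pq}\rangle$ (well defined). Monotone operators: An operator $A\colon X\to 2^{X^*}$ is monotone if $\langle u^*,\overrightarrow{vu}\rangle-\langle v^*,\overrightarrow{vu}\rangle\geq 0$ whenever $u,v\in X$, $u^*\in Au$ and $v^*\in Av$. A monotone operator $A$ satisfies a range condition if for each $x\in X$ there exists $z\in X$ with $[\overrightarrow{zx}]\in Az$. In that case, the resolvent $J_A$ is defined by $J_A(x)=\{z\in X: [\overrightarrow{zx}]\in Az\}$ for $x\in X$, which is a single-valued mapping of $X$ into itself. The zero point set is $A^{-1}(0)=\{u\in X: 0\in Au\}$. *)

(* Defs.v *)
From HB Require Import structures.
From mathcomp Require Import all_boot all_order all_algebra.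
From mathcomp Require Import generic_quotient.
From mathcomp Require Import all_classical all_reals all_analysis.
From mathcomp Require Import ring lra.

Set Implicit Arguments.
Unset Strict Implicit.
Unset Printing Implicit Defensive.

Import Order.TTheory GRing.Theory Num.Theory.
Import numFieldNormedType.Exports.

Local Open Scope classical_set_scope.
Local Open Scope ring_scope.

Section hadamard_space.
Context {R : realType}.

(* The library norm on matrices is the sup norm, hence this definition. *)
Definition euclid_norm (v : 'rV[R]_2) : R :=
  Num.sqrt (\sum_(i < 2) v ord0 i ^+ 2).

Context {X : metricType R}.
Implicit Types x y z : X.

(* A map gamma : [0, d(x, y)] -> X is represented by a function on R of which
   only the values on [0, d(x, y)] matter. *)
Definition is_geodesic x y (gamma : R -> X) :=
  [/\ gamma 0 = x, gamma (mdist x y) = y &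
      {in `[0, mdist x y] &, forall s t, mdist (gamma s) (gamma t) = `|s - t|}].

Definition uniquely_geodesic := forall x y,
  exists2 gamma, is_geodesic x y gamma &
    forall gamma', is_geodesic x y gamma' ->
      {in `[0, mdist x y], gamma' =1 gamma}.

Definition geodesic x y : R -> X := xget (fun=> x) (is_geodesic x y).

(* geo_comb alpha x y is the point (1 - alpha) x (+) alpha y. *)
Definition geo_comb (alpha : R) x y : X := geodesic x y (alpha * mdist x y).

Definition is_CAT0 := uniquely_geodesic /\
  forall x y z (alpha beta : R) (x' y' z' : 'rV[R]_2),
    0 <= alpha <= 1 -> 0 <= beta <= 1 ->
    mdist x y = euclid_norm (x' - y') ->
    mdist y z = euclid_norm (y' - z') ->
    mdist z x = euclid_norm (z' - x') ->
    mdist (geo_comb alpha x y) (geo_comb beta x z) <=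
    euclid_norm ((1 - alpha) *: x' + alpha *: y' -
                 ((1 - beta) *: x' + beta *: z')).

Definition is_hadamard := is_CAT0 /\
  forall u : nat -> X, cauchy (u @ \oo) ->
    exists l : X, u @ \oo --> l.

Definition metric_bounded (B : set X) :=
  exists M : R, forall x y, B x -> B y -> mdist x y <= M.

Definition asymptotic_radius (x_ : nat -> X) (y : X) : \bar R :=
  limn_esup (fun n => (mdist y (x_ n))%:E).

Definition asymptotic_center (x_ : nat -> X) : set X :=
  [set u | asymptotic_radius x_ u = ereal_inf (range (asymptotic_radius x_))].

Definition Delta_cvg (x_ : nat -> X) (p : X) :=
  forall f : nat -> nat, increasing_seq f ->
    asymptotic_center (x_ \o f) = [set p].

Lemma geodesicP x y : uniquely_geodesic -> is_geodesic x y (geodesic x y).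
Proof.
by move=> /(_ x y)[g gP _]; rewrite /geodesic; case: xgetP => // /(_ g).
Qed.

End hadamard_space.
Arguments uniquely_geodesic {R} X.
Arguments is_CAT0 {R} X.
Arguments is_hadamard {R} X.

Section dual_space.
Context {R : realType} {X : metricType R}.
Implicit Types (v w : X * X) (p q : R * (X * X)).

Definition quasilin v w : R :=
  (mdist v.1 w.2 ^+ 2 + mdist v.2 w.1 ^+ 2
   - mdist v.1 w.1 ^+ 2 - mdist v.2 w.2 ^+ 2) / 2.

Definition dual_rel : rel (R * (X * X)) :=
  fun p q => `[< forall w, p.1 * quasilin p.2 w = q.1 * quasilin q.2 w >].

Lemma dual_rel_refl : reflexive dual_rel.
Proof. by move=> p; apply/asboolP. Qed.

Lemma dual_rel_sym : symmetric dual_rel.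
Proof. by move=> p q; apply/asboolP/asboolP => h w; rewrite h. Qed.

Lemma dual_rel_trans : transitive dual_rel.
Proof.
by move=> p q r /asboolP h1 /asboolP h2; apply/asboolP => w; rewrite h1 h2.
Qed.

Canonical dual_equiv :=
  EquivRel dual_rel dual_rel_refl dual_rel_sym dual_rel_trans.

Definition dual := {eq_quot dual_equiv}%qT.

Definition dual_class (a : R) (x y : X) : dual :=
  (\pi_({eq_quot dual_equiv}) (a, (x, y)))%qT.

Definition dual_pairing (u : dual) (x y : X) : R :=
  let: (a, v) := repr u in a * quasilin v (x, y).

Lemma dual_pairingE a x y s t :
  dual_pairing (dual_class a x y) s t = a * quasilin (x, y) (s, t).
Proof.
rewrite /dual_pairing /dual_class.
case: piP => -[b v] /eqmodP /asboolP /(_ (s, t)) /= <-.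
by [].
Qed.

Definition dual0 (a : X) : dual := dual_class 1 a a.

Lemma dual0E (a b : X) : dual0 a = dual0 b.
Proof.
apply/eqmodP/asboolP => w /=; rewrite /quasilin/=; ring.
Qed.

Implicit Types A : X -> set dual.

Definition monotone_op A := forall (u v : X) (us vs : dual),
  A u us -> A v vs -> 0 <= dual_pairing us v u - dual_pairing vs v u.

Definition resolvent A (x : X) : set X := [set z | A z (dual_class 1 z x)].

Definition range_condition A := forall x : X, exists z : X,
  A z (dual_class 1 z x).

(* The element of resolvent A x; see resolvent_mapE. *)
Definition resolvent_map A (x : X) : X := xget x (resolvent A x).

(* By dual0E, the base point of the origin is irrelevant. *)
Definition zeros A : set X := [set u | A u (dual0 u)].

Lemma resolvent_mapE A x : monotone_op A -> range_condition A ->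
  resolvent A x = [set resolvent_map A x].
Proof.
move=> mA /(_ x)[z0 Az0].
have uniq (z y : X) : resolvent A x z -> resolvent A x y -> z = y.
  move=> Az Aw; apply: mdist_positivity.
  have := mA _ _ _ _ Az Aw; rewrite !dual_pairingE /quasilin/=.
  rewrite !mdistxx (metric_sym x y) (metric_sym x z) (metric_sym y z) => h.
  have h2 : mdist z y ^+ 2 <= 0 by lra.
  by apply/eqP; rewrite -sqrf_eq0 eq_le h2 sqr_ge0.
have Jx : resolvent A x (resolvent_map A x).
  by rewrite /resolvent_map; case: xgetP => // /(_ z0).
apply/seteqP; split => [z Az|_ ->]//=; exact: uniq.
Qed.

End dual_space.
Arguments dual {R} X.

(* Main.v *)
Require Import Defs.
From HB Require Import structures.
From mathcomp Require Import all_boot all_order all_algebra.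
From mathcomp Require Import all_classical all_reals all_analysis.
From mathcomp Require Import ring lra.

Set Implicit Arguments.
Unset Strict Implicit.
Unset Printing Implicit Defensive.

Import Order.TTheory GRing.Theory Num.Theory.
Import numFieldNormedType.Exports.

Local Open Scope classical_set_scope.
Local Open Scope ring_scope.

(** The resolvent J of a monotone operator with the range condition satisfies
    [2 d(Jx, Jy)^2 <= d(x, Jy)^2 + d(y, Jx)^2 - d(x, Jx)^2 - d(y, Jy)^2]:
    this is monotonicity at the points Jx and Jy, for the classes of the vectors
    from Jx to x and from Jy to y, with the pairings expanded (lemma
    [resolvent_firmly_nonspreading]). The zeros of the operator are the fixed
    points of J, so the theorem is about Mann iterations [u] of a map [T] with
    this property.

    The geometry enters through the inequality
    [d((1-t)x + ty, z)^2 <= (1-t) d(x,z)^2 + t d(y,z)^2 - t(1-t) d(x,y)^2]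
    (lemma [CAT0_inequality]). It makes squared distances strongly convex, and
    this passes to averages and to upper limits, so an upper limit of averages
    of squared distances to a bounded sequence has a unique minimizer in a
    complete space (lemma [limsup_minimizer]). A fixed point of [T] is always
    found as such a minimizer [p], by showing that the value at [T p] does not
    exceed the value at [p].

    If [u] is bounded, the functional is the upper limit of the averages of
    [d(T u_k, y)^2] with weights [alpha_k]. The inequality for [T] bounds
    [d(T u_k, T y)^2 - d(T u_k, y)^2] by [d(u_k, T y)^2 - d(T u_k, T y)^2],
    whose alpha-weighted sum telescopes along the iteration and stays bounded;
    since the alpha_k have an infinite sum, the averages at [T y] exceed those
    at [y] by a vanishing amount (lemma [mann_fixed_point]). Conversely, the
    distance from [u_n] to a fixed point never increases (lemma [mann_fejer]).

    If the alpha_n are bounded away from 0, the decrease of [d(u_n, p)^2] also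
    forces [d(u_n, T u_n)] to tend to 0, and then the asymptotic center of every
    subsequence is a fixed point. The distance from [u_n] to a fixed point being
    monotone, its upper limit is the same along each subsequence; hence all
    these centers minimize the same quantity and coincide
    (lemma [mann_Delta_cvg]). *)

(** * Comparison triangles and the CAT(0) inequality *)

Section comparison.
Context {R : realType}.

Let vec2 (s t : R) : 'rV[R]_2 := \row_i (if i == ord0 then s else t).

Let euclid_vec2 s t : euclid_norm (vec2 s t) = Num.sqrt (s ^+ 2 + t ^+ 2).
Proof. by rewrite /euclid_norm big_ord_recr big_ord1/= !mxE. Qed.

(** The vertices are (0, 0), (a, 0) and (s, t), where s is given by the law of
    cosines. The last clause is Stewart's theorem for this triangle. *)
Lemma comparison_triangle (a b c : R) : 0 <= a -> 0 <= b -> 0 <= c ->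
  a <= b + c -> b <= a + c -> c <= a + b ->
  exists x y z : 'rV[R]_2, [/\ a = euclid_norm (x - y),
    b = euclid_norm (z - x), c = euclid_norm (y - z) &
    forall t : R, euclid_norm ((1 - t) *: x + t *: y - z) ^+ 2 =
      (1 - t) * b ^+ 2 + t * c ^+ 2 - t * (1 - t) * a ^+ 2].
Proof.
move=> a0 b0 c0 abc bac cab.
have [s [t [st sta]]] : exists s t,
    s ^+ 2 + t ^+ 2 = b ^+ 2 /\ (a - s) ^+ 2 + t ^+ 2 = c ^+ 2.
  (* The law of cosines divides by a; a degenerate base forces b = c. *)
  have [aE|a_neq0] := eqVneq a 0.
    exists b, 0; have -> : c = b by lra.
    by rewrite aE; split; ring.
  pose s := (a ^+ 2 + b ^+ 2 - c ^+ 2) / (2 * a).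
  have sE : 2 * a * s = a ^+ 2 + b ^+ 2 - c ^+ 2.
    by rewrite /s mulrC divfK// mulf_neq0// pnatr_eq0.
  have agt0 : 0 < a by rewrite lt_neqAle eq_sym a_neq0.
  have s_le : s <= b.
    have : 2 * a * s <= 2 * a * b by rewrite sE; nra.
    by rewrite ler_pM2l// mulr_gt0.
  have s_ge : - b <= s.
    have : 2 * a * (- b) <= 2 * a * s by rewrite sE; nra.
    by rewrite ler_pM2l// mulr_gt0.
  exists s, (Num.sqrt (b ^+ 2 - s ^+ 2)); rewrite sqr_sqrtr; last by nra.
  by split; [ring|lra].
have norm_sqr u v w : 0 <= w -> u ^+ 2 + v ^+ 2 = w ^+ 2 ->
    w = euclid_norm (vec2 u v).
  by move=> w0 uvw; rewrite euclid_vec2 uvw sqrtr_sqr ger0_norm.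
exists 0, (vec2 a 0), (vec2 s t); split.
- rewrite (_ : 0 - vec2 a 0 = vec2 (- a) 0); last first.
    by apply/rowP => i; rewrite !mxE; case: ifP => _; ring.
  by apply: norm_sqr => //; ring.
- by rewrite subr0; exact: norm_sqr.
- rewrite (_ : vec2 a 0 - vec2 s t = vec2 (a - s) (- t)); last first.
    by apply/rowP => i; rewrite !mxE; case: ifP => _; ring.
  by apply: norm_sqr => //; rewrite -sta; ring.
- move=> r; rewrite (_ : _ - vec2 s t = vec2 (r * a - s) (- t)); last first.
    by apply/rowP => i; rewrite !mxE; case: ifP => _; ring.
  rewrite euclid_vec2 sqr_sqrtr; last by rewrite addr_ge0// sqr_ge0.
  rewrite -sta -st; ring.
Qed.

Context {X : metricType R}.
Implicit Types x y z : X.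

(** Comparison of a point of the side [x, y] with the vertex z, which is the
    point of parameter 1 of the side [x, z]. *)
Lemma CAT0_inequality x y z (t : R) : is_CAT0 X -> 0 <= t <= 1 ->
  mdist (geo_comb t x y) z ^+ 2 <=
  (1 - t) * mdist x z ^+ 2 + t * mdist y z ^+ 2 - t * (1 - t) * mdist x y ^+ 2.
Proof.
move=> [geoX cmpX] t01.
have xyz : mdist x y <= mdist z x + mdist y z.
  by rewrite (metric_sym z) (metric_sym y); exact: metric_triangle.
have zyx : mdist z x <= mdist x y + mdist y z.
  by rewrite addrC (metric_sym y) (metric_sym x); exact: metric_triangle.
have yxz : mdist y z <= mdist x y + mdist z x.
  by rewrite (metric_sym x) (metric_sym z); exact: metric_triangle.
have [x' [y' [z' [xy zx yz tE]]]] :=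
  comparison_triangle (mdist_ge0 x y) (mdist_ge0 z x) (mdist_ge0 y z)
    xyz zyx yxz.
have one01 : 0 <= (1 : R) <= 1 by rewrite ler01 lexx.
have geo1 : geo_comb 1 x z = z.
  by rewrite /geo_comb mul1r; have [] := geodesicP x z geoX.
have := cmpX x y z t 1 x' y' z' t01 one01 xy yz zx.
rewrite geo1 subrr scale0r add0r scale1r => le.
rewrite (metric_sym x z) -tE ler_sqr// ?nnegrE ?mdist_ge0//.
exact: sqrtr_ge0.
Qed.

End comparison.

(** * Upper limits of bounded nonnegative sequences *)

Section limsup.
Context {R : realType}.
Implicit Types (u v : nat -> R) (c : R).

Lemma limn_esup_leP u c : reflect
  (forall e, 0 < e -> \forall n \near \oo, u n <= c + e)
  (limn_esup (fun n => (u n)%:E) <= c%:E)%E.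
Proof.
rewrite /limn_esup /limf_esup; apply: (iffP idP) => [le e e0|le].
  have : (ereal_inf [set ereal_sup ((fun n => (u n)%:E) @` A) | A in \oo] <
          (c + e)%:E)%E by rewrite (le_lt_trans le)// lte_fin ltrDl.
  move=> /ereal_inf_lt[_ [A Aoo <-]] lt; apply: filterS Aoo => n An.
  by rewrite -lee_fin (le_trans _ (ltW lt))//; apply: ereal_sup_ubound; exists n.
apply/lee_addgt0Pr => e e0; apply: ge_ereal_inf.
exists (ereal_sup [set (u n)%:E | n in [set n | u n <= c + e]]).
  by exists [set n | u n <= c + e] => //; exact: le.
by apply: ge_ereal_sup => _ [n /= nle <-]; rewrite -EFinD lee_fin.
Qed.

(** The real-valued version allows arithmetic on upper limits; it agrees with
    the extended one on bounded sequences, see [limsupE]. *)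
Definition limsup u : R := fine (limn_esup (fun n => (u n)%:E)).

Definition bounded_nneg u := (forall n, 0 <= u n) /\ exists M, forall n, u n <= M.

Lemma limsupE u : bounded_nneg u ->
  limn_esup (fun n => (u n)%:E) = (limsup u)%:E.
Proof.
move=> [u0 [M uM]]; rewrite fineK// fin_real//; apply/andP; split.
  apply: (@lt_le_trans _ _ 0%E) => //; apply: le_ereal_inf_tmp => _ [A Aoo <-].
  have [n An] := filter_ex Aoo.
  rewrite (@le_trans _ _ (u n)%:E) ?lee_fin//.
  by apply: ereal_sup_ubound; exists n.
apply: (@le_lt_trans _ _ M%:E); last exact: ltry.
apply/limn_esup_leP => e e0; apply: nearW => n.
by rewrite (le_trans (uM n))// lerDl ltW.
Qed.

Lemma limsup_leP u c : bounded_nneg u -> reflect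
  (forall e, 0 < e -> \forall n \near \oo, u n <= c + e) (limsup u <= c).
Proof. by move=> bu; rewrite -lee_fin -limsupE//; exact: limn_esup_leP. Qed.

Lemma limsup_near u e : bounded_nneg u -> 0 < e ->
  \forall n \near \oo, u n <= limsup u + e.
Proof. by move=> bu; exact: (elimT (limsup_leP _ bu)). Qed.

Lemma limsup_ge0 u : bounded_nneg u -> 0 <= limsup u.
Proof.
move=> bu; apply/ler_addgt0Pr => e e0.
have [n un] := filter_ex (limsup_near bu e0).
exact: le_trans (bu.1 n) un.
Qed.

Lemma le_limsup u v : bounded_nneg u -> bounded_nneg v ->
  (forall e, 0 < e -> \forall n \near \oo, u n <= v n + e) ->
  limsup u <= limsup v.
Proof.
move=> bu bv uv; apply/limsup_leP => // e e0.
have e20 : 0 < e / 2 by rewrite divr_gt0.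
apply: filterS2 (uv _ e20) (limsup_near bv e20) => n un vn.
by rewrite (le_trans un)//; lra.
Qed.

Lemma bounded_nneg_sqr u : bounded_nneg u -> bounded_nneg (fun n => u n ^+ 2).
Proof.
move=> [u0 [M uM]]; split=> [n|]; first exact: sqr_ge0.
exists (M ^+ 2) => n; rewrite ler_sqr// nnegrE//.
exact: le_trans (u0 n) (uM n).
Qed.

(** Asymptotic centers minimize upper limits of distances, whereas strong
    convexity concerns squared distances; this equality links the two. *)
Lemma limsup_sqr u : bounded_nneg u -> limsup (fun n => u n ^+ 2) = limsup u ^+ 2.
Proof.
move=> bu; have bu2 := bounded_nneg_sqr bu.
have L0 := limsup_ge0 bu; have L20 := limsup_ge0 bu2.
set L := limsup u in L0 *; set L2 := limsup _ in L20 *.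
apply/eqP; rewrite eq_le; apply/andP; split.
  apply/limsup_leP => // e e0.
  (* With 0 <= d <= 1, (L + d)^2 <= L^2 + d (2 L + 1). *)
  pose d := Num.min 1 (e / (2 * L + 1)).
  have d0 : 0 < d by rewrite lt_min ltr01 divr_gt0//; lra.
  have d1 : d <= 1 by rewrite ge_min lexx.
  have dE : d * (2 * L + 1) <= e.
    by rewrite -ler_pdivlMr ?ge_min ?lexx ?orbT//; lra.
  apply: filterS (limsup_near bu d0) => n; rewrite -/L => un.
  have un0 := bu.1 n; nra.
suff : L <= Num.sqrt L2 by move=> le; rewrite -(sqr_sqrtr L20) ler_sqr ?nnegrE.
apply/limsup_leP => // e e0.
have e20 : 0 < e ^+ 2 by rewrite exprn_gt0.
apply: filterS (limsup_near bu2 e20) => n; rewrite -/L2 => un.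
have s0 := sqrtr_ge0 L2; have sE := sqr_sqrtr L20.
have rhs0 : 0 <= Num.sqrt L2 + e by rewrite addr_ge0// ltW.
rewrite -ler_sqr ?nnegrE ?bu.1//; apply: le_trans un _; nra.
Qed.

End limsup.

(** * Minimizers of strongly convex functionals *)

Section minimization.
Context {R : realType} {X : metricType R}.
Implicit Types (x y z p q : X) (g : X -> R) (h : nat -> X -> R).

Definition midpoint_strongly_convex g := forall x y,
  g (geo_comb 2^-1 x y) <= (g x + g y) / 2 - mdist x y ^+ 2 / 4.

(** Two points where [g] is within e of its infimum are at squared distance at
    most 4 e, because [g] at their midpoint cannot go below the infimum; so
    minimizing sequences are Cauchy. The one-sided Lipschitz condition at each
    point gives the lower semicontinuity needed at the limit. *)
Lemma strongly_convex_minimizer g : is_hadamard X -> X ->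
  (forall y, 0 <= g y) -> midpoint_strongly_convex g ->
  (forall p, exists K, forall y, g p <= g y + K * mdist p y) ->
  exists p, forall y, g p <= g y.
Proof.
move=> [_ complX] x0 g0 gcvx glip.
have inf_g : has_inf (range g).
  by split; [exists (g x0), x0|exists 0 => _ [y _ <-]].
set m := inf (range g).
have m_le y : m <= g y by apply: ge_inf; [exact: inf_g.2|exists y].
have /choice[a aE] (n : nat) : exists y, g y <= m + n.+1%:R^-1.
  have n0 : 0 < n.+1%:R^-1 :> R by rewrite invr_gt0.
  by have [_ [y _ <-] /ltW] := inf_adherent n0 inf_g; exists y.
have close e x y : g x <= m + e -> g y <= m + e -> mdist x y ^+ 2 <= 4 * e.
  by move=> gx gy; have := gcvx x y; have := m_le (geo_comb 2^-1 x y); lra.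
have a_cauchy : cauchy (a @ \oo).
  apply: cauchy_exP => e e0.
  have e24 : 0 < e ^+ 2 / 4 by rewrite divr_gt0// exprn_gt0.
  have [N _ Ne] := near_infty_natSinv_lt (PosNum e24).
  exists (a N); 
  have : \forall n \near \oo, ball (a N) e (a n); last by [].
  apply: filterS (nbhs_infty_ge N) => n Nn.
  rewrite ballEmdist /= -ltr_sqr ?nnegrE ?mdist_ge0 ?(ltW e0)//.
  have /close : g (a N) <= m + N.+1%:R^-1 := aE N.
  move=> /(_ (a n)) le; apply: (le_lt_trans (le _)).
    by rewrite (le_trans (aE n))// lerD2l lef_pV2 ?posrE ?ltr0n// ler_nat.
  have lt : N.+1%:R^-1 < e ^+ 2 / 4 := Ne N (leqnn N).
  by rewrite mulrC -ltr_pdivlMr.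
have [p ap] := complX a a_cauchy.
exists p; suff gp : g p <= m by move=> y; exact: le_trans gp (m_le y).
have [K gK] := glip p.
apply/ler_addgt0Pr => e e0.
have e20 : 0 < e / 2 by rewrite divr_gt0.
have d0 : 0 < e / 2 / (`|K| + 1) by rewrite divr_gt0// ltr_wpDl.
have [n [an pn]] : exists n,
    n.+1%:R^-1 < e / 2 /\ mdist p (a n) < e / 2 / (`|K| + 1).
  have near_n := near_infty_natSinv_lt (PosNum e20).
  have /cvg_ballP/(_ _ d0) := ap; rewrite ballEmdist => near_p.
  exact: filter_ex (filterI near_n near_p).
have Kd : K * mdist p (a n) <= e / 2.
  rewrite ltr_pdivlMr ?ltr_wpDl// in pn.
  apply: le_trans (ltW pn); rewrite mulrC ler_wpM2l ?mdist_ge0//.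
  by have := ler_norm K; lra.
have ga : g (a n) <= m + e / 2 by rewrite (le_trans (aE n))// lerD2l ltW.
by have := gK (a n); lra.
Qed.

(** The midpoint inequality and the one-sided Lipschitz bounds, being uniform in
    n, are inherited by the upper limit. *)
Lemma limsup_minimizer h : is_hadamard X -> X ->
  (forall y, bounded_nneg (h^~ y)) ->
  (forall n, midpoint_strongly_convex (h n)) ->
  (forall p, exists K, forall n y, h n p <= h n y + K * mdist p y) ->
  exists p, (forall y, limsup (h^~ p) <= limsup (h^~ y)) /\
    forall q, limsup (h^~ q) <= limsup (h^~ p) -> q = p.
Proof.
move=> hadX x0 hb hcvx hlip.
pose g y := limsup (h^~ y).
have gcvx : midpoint_strongly_convex g.
  move=> x y; apply/limsup_leP => // e e0.
  apply: filterS2 (limsup_near (hb x) e0) (limsup_near (hb y) e0) => n hx hy.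
  by have := hcvx n x y; rewrite /g; lra.
have glip p : exists K, forall y, g p <= g y + K * mdist p y.
  have [K hK] := hlip p; exists K => y; apply/limsup_leP => // e e0.
  apply: filterS (limsup_near (hb y) e0) => n hy.
  by have := hK n y; rewrite /g; lra.
have [p pmin] := strongly_convex_minimizer hadX x0
  (fun y => limsup_ge0 (hb y)) gcvx glip.
exists p; split=> // q qp; apply: mdist_positivity; apply/eqP.
rewrite -sqrf_eq0 eq_le sqr_ge0 andbT.
have {}qp : g q <= g p := qp.
have p_le : g p <= g (geo_comb 2^-1 q p) := pmin _.
by have := gcvx q p; lra.
Qed.

Lemma midpoint_strongly_convex_sqr_dist z : is_CAT0 X ->
  midpoint_strongly_convex (fun y => mdist z y ^+ 2).
Proof.
move=> catX x y /=.
have half01 : 0 <= (2^-1 : R) <= 1 by lra.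
have := CAT0_inequality x y z catX half01.
by rewrite (metric_sym z) (metric_sym z x) (metric_sym z y); lra.
Qed.

Lemma sqr_dist_le z p y (M : R) : mdist z p <= M ->
  mdist z p ^+ 2 <= mdist z y ^+ 2 + 2 * M * mdist p y.
Proof.
move=> zpM; have := metric_triangle z y p; rewrite (metric_sym y p).
have := mdist_ge0 z p; have := mdist_ge0 z y; have := mdist_ge0 p y.
set d := mdist p y; set a := mdist z p in zpM *; set b := mdist z y.
move=> d0 b0 a0 abd; have [ab|/ltW ba] := leP a b.
  have : 0 <= M * d by rewrite mulr_ge0//; lra.
  nra.
have : (a - b) * (a + b) <= d * (2 * M) by rewrite ler_pM ?subr_ge0//; lra.
lra.
Qed.

End minimization.

(** * Asymptotic centers *)

Lemma near_increasing_seq (f : nat -> nat) (P : set nat) : increasing_seq f ->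
  (\forall n \near \oo, P n) -> \forall n \near \oo, P (f n).
Proof.
move=> f_incr [N _ NP]; exists N => // n /= Nn; apply: NP => /=.
apply: leq_trans Nn _; elim: n => // n IHn.
have f_mono : (f n.+1 <= f n)%N = (n.+1 <= n)%N := f_incr n.+1 n.
by rewrite (leq_ltn_trans IHn)// ltnNge f_mono ltnn.
Qed.

Section asymptotic.
Context {R : realType} {X : metricType R}.
Implicit Types (u : nat -> X) (y p : X).

Definition bounded_seq u := forall y, bounded_nneg (fun n => mdist (u n) y).

Lemma metric_bounded_seq u : metric_bounded (range u) -> bounded_seq u.
Proof.
move=> [M uM] y; split=> [n|]; first exact: mdist_ge0.
exists (M + mdist (u 0%N) y) => n.
by rewrite (le_trans (metric_triangle _ (u 0%N) _))// lerD2r; apply: uM; eexists.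
Qed.

Lemma bounded_seqP u y (M : R) : (forall n, mdist (u n) y <= M) ->
  metric_bounded (range u).
Proof.
move=> uM; exists (M + M) => _ _ [m _ <-] [n _ <-].
by rewrite (le_trans (metric_triangle _ y _))// lerD// metric_sym.
Qed.

Lemma bounded_seq_comp u (f : nat -> nat) : bounded_seq u -> bounded_seq (u \o f).
Proof.
move=> ub y; have [d0 [M dM]] := ub y.
by split=> [n|]; [exact: d0|exists M => n; exact: dM].
Qed.

Definition limsup_dist u y : R := limsup (fun n => mdist (u n) y).

Lemma asymptotic_centerP u : is_hadamard X -> bounded_seq u ->
  exists p, [/\ asymptotic_center u = [set p],
    forall y, limsup_dist u p <= limsup_dist u y &
    forall q, limsup_dist u q <= limsup_dist u p -> q = p].
Proof.
move=> hadX ub.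
have radE y : asymptotic_radius u y = (limsup_dist u y)%:E.
  rewrite /asymptotic_radius -limsupE//.
  by congr limn_esup; apply/funext => n; rewrite metric_sym.
have [p [pmin puniq]] : exists p,
    (forall y, limsup_dist u p <= limsup_dist u y) /\
    forall q, limsup_dist u q <= limsup_dist u p -> q = p.
  have rad0 y : 0 <= limsup_dist u y by exact: limsup_ge0.
  have sqrE y : limsup (fun n => mdist (u n) y ^+ 2) = limsup_dist u y ^+ 2.
    exact: limsup_sqr.
  have [|||p [pmin puniq]] :=
      @limsup_minimizer _ X (fun n y => mdist (u n) y ^+ 2) hadX (u 0%N).
  - by move=> y; exact: bounded_nneg_sqr.
  - by move=> n; apply: midpoint_strongly_convex_sqr_dist; exact: hadX.1.
  - move=> p; have [_ [M uM]] := ub p; exists (2 * M) => n y.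
    exact: sqr_dist_le.
  exists p; split=> [y|q qp].
    by have := pmin y; rewrite !sqrE ler_sqr// nnegrE.
  by apply: puniq; rewrite !sqrE ler_sqr// nnegrE.
have infE : ereal_inf (range (asymptotic_radius u)) = asymptotic_radius u p.
  apply/eqP; rewrite eq_le; apply/andP; split.
    by apply: ereal_inf_lbound; exists p.
  by apply: le_ereal_inf_tmp => _ [y _ <-]; rewrite !radE lee_fin.
exists p; split=> //; apply/seteqP; split=> [q|_ ->];
  rewrite /asymptotic_center /= infE//.
by rewrite !radE => -[qp]; apply: puniq; rewrite qp.
Qed.

End asymptotic.

(** * Resolvents as firmly nonspreading maps *)

Section firmly_nonspreading.
Context {R : realType} {X : metricType R}.
Implicit Types (x y z p : X) (T : X -> X) (A : X -> set (dual X)).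

Definition firmly_nonspreading T := forall x y,
  2 * mdist (T x) (T y) ^+ 2 <= mdist x (T y) ^+ 2 + mdist y (T x) ^+ 2
    - mdist x (T x) ^+ 2 - mdist y (T y) ^+ 2.

Lemma resolvent_mapP A x : range_condition A ->
  A (resolvent_map A x) (dual_class 1 (resolvent_map A x) x).
Proof.
move=> /(_ x)[z Az].
by rewrite /resolvent_map; case: xgetP => [y -> //|/(_ z)].
Qed.

Lemma resolvent_firmly_nonspreading A : monotone_op A -> range_condition A ->
  firmly_nonspreading (resolvent_map A).
Proof.
move=> monA ranA x y.
have := monA _ _ _ _ (resolvent_mapP x ranA) (resolvent_mapP y ranA).
rewrite !dual_pairingE /quasilin /= !mdistxx.
set Jx := resolvent_map A x; set Jy := resolvent_map A y.
rewrite (metric_sym Jy Jx) (metric_sym x Jx) (metric_sym y Jy); lra.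
Qed.

Lemma zerosE A p : monotone_op A -> range_condition A ->
  zeros A p <-> resolvent_map A p = p.
Proof.
move=> monA ranA; split=> [Ap|Jp].
  have : resolvent A p p by [].
  by rewrite resolvent_mapE//= => ->.
by have := resolvent_mapP p ranA; rewrite Jp.
Qed.

Variable T : X -> X.
Hypothesis T_fns : firmly_nonspreading T.

Lemma firmly_nonspreading_fixed x p : T p = p ->
  mdist (T x) p ^+ 2 <= mdist x p ^+ 2 - mdist x (T x) ^+ 2.
Proof.
by move=> Tp; have := T_fns x p; rewrite Tp mdistxx (metric_sym p); lra.
Qed.

Lemma firmly_nonspreading_bounded (u : nat -> X) :
  bounded_seq u -> bounded_seq (T \o u).
Proof.
move=> ub y; split=> [n|]; first exact: mdist_ge0.
have [_ [M uM]] := ub (T y).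
exists (M + 3 * mdist y (T y)) => n /=.
have := T_fns (u n) y; have := uM n; have := mdist_ge0 (u n) (T y).
have := metric_triangle y (T y) (T (u n)).
have := metric_triangle (T (u n)) (T y) y.
have := mdist_ge0 y (T y); have := mdist_ge0 (T (u n)) (T y).
have := mdist_ge0 y (T (u n)); have := sqr_ge0 (mdist (u n) (T (u n))).
rewrite (metric_sym (T y) y) (metric_sym (T y) (T (u n))).
set r := mdist _ (T y); set c := mdist y (T y); set D := mdist y _.
set a := mdist _ (T y); set b := mdist _ (T _) ^+ 2.
move=> b0 D0 r0 c0 le_rc D_le a0 aM fns.
(* fns, a <= M and D <= c + r give r^2 <= M^2 + 2 c r. *)
suff : r <= M + 2 * c by lra.
have D2 : D ^+ 2 <= (c + r) ^+ 2 by rewrite ler_sqr ?nnegrE ?addr_ge0.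
have a2 : a ^+ 2 <= M ^+ 2 by rewrite ler_sqr ?nnegrE ?(le_trans a0).
rewrite leNgt; apply/negP => lt; nra.
Qed.

(** When d(v_n, T v_n) tends to 0, [v n] may replace [T (v n)] in the defining
    inequality up to a vanishing error, which leaves
    [d(v_n, T y) <= d(v_n, y) + o(1)]. *)
Lemma firmly_nonspreading_limsup (v : nat -> X) y : bounded_seq v ->
  (forall e, 0 < e -> \forall n \near \oo, mdist (v n) (T (v n)) <= e) ->
  limsup_dist v (T y) <= limsup_dist v y.
Proof.
move=> vb v_reg; apply: le_limsup => // e e0.
have e40 : 0 < e / 4 by rewrite divr_gt0.
apply: filterS (v_reg _ e40) => n.
have := T_fns (v n) y.
have := metric_triangle (v n) (T (v n)) (T y).
have := metric_triangle y (v n) (T (v n)).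
have := mdist_ge0 (v n) (T (v n)); have := mdist_ge0 (v n) y.
have := mdist_ge0 (T (v n)) (T y); have := mdist_ge0 (v n) (T y).
have := mdist_ge0 y (T (v n)); have := sqr_ge0 (mdist y (T y)).
rewrite (metric_sym y (v n)).
set r := mdist (T _) (T y); set d := mdist (v n) (T (v n)).
set a := mdist (v n) (T y); set b := mdist y (T (v n)); set D := mdist _ y.
move=> c0 b0 a0 r0 D0 d0 b_le a_le fns d_le.
(* fns, a <= d + r and b <= D + d give r^2 <= 2 r d + (D + d)^2, that is
   (r - d)^2 <= (D + d)^2 + d^2, which is at most (D + 2 d)^2. *)
suff : r <= D + 3 * d by lra.
have b2 : b ^+ 2 <= (D + d) ^+ 2 by rewrite ler_sqr ?nnegrE ?addr_ge0.
have a2 : a ^+ 2 <= (d + r) ^+ 2 by rewrite ler_sqr ?nnegrE ?addr_ge0.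
rewrite leNgt; apply/negP => lt; nra.
Qed.

End firmly_nonspreading.

(** * Weighted averages *)

Section weighted_average.
Context {R : realType}.
Variable alpha : nat -> R.
Hypothesis alpha_gt0 : forall n, 0 < alpha n.
Implicit Types (f g : nat -> R).

Lemma weight_gt0 n : 0 < \sum_(0 <= k < n.+1) alpha k.
Proof.
rewrite big_nat_recl// ltr_wpDr//.
by apply: sumr_ge0 => i _; exact: ltW.
Qed.

(** The sums run up to n included, so that the denominator is never zero. *)
Definition wavg n f : R :=
  (\sum_(0 <= k < n.+1) alpha k * f k) / (\sum_(0 <= k < n.+1) alpha k).

Lemma le_wavg n f g : (forall k, f k <= g k) -> wavg n f <= wavg n g.
Proof.
move=> fg; rewrite ler_pM2r ?invr_gt0 ?weight_gt0//.
by apply: ler_sum => k _; rewrite ler_pM2l.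
Qed.

Lemma wavg_cst n c : wavg n (fun=> c) = c.
Proof.
by rewrite /wavg -mulr_suml mulrC mulKf// gt_eqF// weight_gt0.
Qed.

Lemma wavgD n f g : wavg n (fun k => f k + g k) = wavg n f + wavg n g.
Proof.
rewrite /wavg -mulrDl -big_split/=; congr (_ / _).
by apply: eq_bigr => k _; rewrite mulrDr.
Qed.

Lemma wavgZ n c f : wavg n (fun k => c * f k) = c * wavg n f.
Proof.
rewrite /wavg mulrA mulr_sumr; congr (_ / _).
by apply: eq_bigr => k _; rewrite mulrCA.
Qed.

Lemma near_inv_weight (C : R) : (\sum_(0 <= n <oo) (alpha n)%:E = +oo)%E ->
  forall e, 0 < e -> \forall n \near \oo,
    C / (\sum_(0 <= k < n.+1) alpha k) <= e.
Proof.
move=> sumoo e e0.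
have : (fun n => \sum_(0 <= k < n) (alpha k)%:E)%E @ \oo --> +oo%E.
  rewrite -sumoo; apply: is_cvg_nneseries => n _ _.
  by rewrite lee_fin ltW.
move=> /cvgeyPge/(_ (C / e))[N _ large]; exists N => // n /= Nn.
rewrite ler_pdivrMr ?weight_gt0// mulrC -ler_pdivrMr// -lee_fin -sumEFin.
exact/large/leqW.
Qed.

End weighted_average.

(** * Mann iterations of firmly nonspreading maps *)

Section mann_iteration.
Context {R : realType} {X : metricType R}.
Variables (T : X -> X) (alpha : nat -> R) (u : nat -> X).
Hypothesis hadX : is_hadamard X.
Hypothesis T_fns : firmly_nonspreading T.
Hypothesis alpha01 : forall n, 0 < alpha n <= 1.
Hypothesis u_rec : forall n, u n.+1 = geo_comb (alpha n) (u n) (T (u n)).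
Implicit Types (y p : X).

Let alpha_gt0 n : 0 < alpha n.
Proof. by have /andP[] := alpha01 n. Qed.

Lemma mann_step n y :
  mdist (u n.+1) y ^+ 2 <= mdist (u n) y ^+ 2 +
    alpha n * (mdist (T (u n)) y ^+ 2 - mdist (u n) y ^+ 2).
Proof.
have /andP[an0 an1] := alpha01 n.
have an01 : 0 <= alpha n <= 1 by rewrite ltW.
rewrite u_rec; have := CAT0_inequality (u n) (T (u n)) y hadX.1 an01.
have : 0 <= alpha n * (1 - alpha n) * mdist (u n) (T (u n)) ^+ 2.
  by rewrite mulr_ge0 ?sqr_ge0// mulr_ge0 ?subr_ge0// ltW.
lra.
Qed.

Lemma mann_fixed_step n p : T p = p ->
  mdist (u n.+1) p ^+ 2 <=
  mdist (u n) p ^+ 2 - alpha n * mdist (u n) (T (u n)) ^+ 2.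
Proof.
move=> Tp; apply: le_trans (mann_step n p) _.
by rewrite lerD2l -(mulrN (alpha n)) ler_pM2l// lerBlDl firmly_nonspreading_fixed.
Qed.

Lemma mann_fejer p : T p = p -> nonincreasing_seq (fun n => mdist (u n) p).
Proof.
move=> Tp; apply/nonincreasing_seqP => n.
rewrite -ler_sqr ?nnegrE ?mdist_ge0//; apply: le_trans (mann_fixed_step n Tp) _.
by rewrite gerBl mulr_ge0 ?sqr_ge0// ltW.
Qed.

Lemma mann_bounded p : T p = p -> metric_bounded (range u).
Proof.
move=> Tp; apply: (@bounded_seqP _ _ _ p (mdist (u 0%N) p)) => n.
exact: mann_fejer.
Qed.

(** Each term is at most alpha_k (d(u_k, T y)^2 - d(T u_k, T y)^2), since [T] is
    firmly nonspreading, hence at most the decrease of d(u_k, T y)^2 in the k-th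
    step; these decreases telescope. *)
Lemma mann_weighted_sum n y :
  \sum_(0 <= k < n) alpha k *
    (mdist (T (u k)) (T y) ^+ 2 - mdist (T (u k)) y ^+ 2)
  <= mdist (u 0%N) (T y) ^+ 2 - mdist (u n) (T y) ^+ 2.
Proof.
elim: n => [|n IHn]; first by rewrite big_nil subrr.
rewrite big_nat_recr//=.
have step := mann_step n (T y).
have fns : mdist (T (u n)) (T y) ^+ 2 - mdist (T (u n)) y ^+ 2 <=
           mdist (u n) (T y) ^+ 2 - mdist (T (u n)) (T y) ^+ 2.
  have := T_fns (u n) y; rewrite (metric_sym y (T (u n))).
  have := sqr_ge0 (mdist (u n) (T (u n))); have := sqr_ge0 (mdist y (T y)); lra.
rewrite -(ler_pM2l (alpha_gt0 n)) in fns; lra.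
Qed.

(** The minimizer p of the upper limit of the averages of d(T u_k, y)^2 is fixed:
    the averages at [T p] exceed those at [p] by at most d(u_0, T p)^2 divided by
    the total weight, which tends to 0. *)
Lemma mann_fixed_point : (\sum_(0 <= n <oo) (alpha n)%:E = +oo)%E ->
  metric_bounded (range u) -> exists p, T p = p.
Proof.
move=> sumoo /metric_bounded_seq ub.
have Tub := firmly_nonspreading_bounded T_fns ub.
pose h n y := wavg alpha n (fun k => mdist (T (u k)) y ^+ 2).
have h_bounded y : bounded_nneg (h^~ y).
  have [sq0 [M sqM]] := bounded_nneg_sqr (Tub y).
  split=> [n|]; first by rewrite -(wavg_cst alpha_gt0 n 0); exact: le_wavg.
  by exists M => n; rewrite -(wavg_cst alpha_gt0 n M); exact: le_wavg.
have h_convex n : midpoint_strongly_convex (h n).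
  move=> x y; have -> : (h n x + h n y) / 2 - mdist x y ^+ 2 / 4 =
      wavg alpha n (fun k => 2^-1 * (mdist (T (u k)) x ^+ 2 +
        mdist (T (u k)) y ^+ 2) + - (mdist x y ^+ 2 / 4)).
    by rewrite wavgD wavgZ wavgD wavg_cst// mulrC.
  apply: le_wavg => // k.
  have := midpoint_strongly_convex_sqr_dist (T (u k)) hadX.1 x y.
  by rewrite /= [X in _ <= X - _ -> _]mulrC.
have h_lip p : exists K, forall n y, h n p <= h n y + K * mdist p y.
  have [_ [M TuM]] := Tub p; exists (2 * M) => n y.
  rewrite -[in leRHS](wavg_cst alpha_gt0 n (2 * M * _)) -wavgD.
  by apply: le_wavg => // k; apply: sqr_dist_le; exact: TuM.
have [p [_ p_uniq]] := limsup_minimizer hadX (u 0%N) h_bounded h_convex h_lip.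
exists p; apply: p_uniq; apply: le_limsup => // e e0.
apply: filterS (near_inv_weight alpha_gt0 (mdist (u 0%N) (T p) ^+ 2) sumoo e0).
move=> n Cn; apply: le_trans (_ : _ <= h n p + _) _.
  2: by rewrite lerD2l; exact: Cn.
rewrite /h /wavg -mulrDl ler_pM2r ?invr_gt0 ?weight_gt0//.
rewrite -lerBlDl -sumrB; under eq_bigr do rewrite -mulrBr.
apply: le_trans (mann_weighted_sum _ _) _.
by rewrite gerBl sqr_ge0.
Qed.

(** In each step d(u_n, p)^2 loses at least c d(u_n, T u_n)^2, so once it is
    within c e^2 of its infimum, d(u_n, T u_n) <= e. *)
Lemma mann_asymptotic_regular p (c : R) : T p = p -> 0 < c ->
  (forall n, c <= alpha n) ->
  forall e, 0 < e -> \forall n \near \oo, mdist (u n) (T (u n)) <= e.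
Proof.
move=> Tp c0 c_le e e0.
pose a n := mdist (u n) p ^+ 2.
have inf_a : has_inf (range a).
  by split; [exists (a 0%N), 0%N|exists 0 => _ [n _ <-]; exact: sqr_ge0].
have ce0 : 0 < c * e ^+ 2 by rewrite mulr_gt0// exprn_gt0.
have [_ [N _ <-] aN] := inf_adherent ce0 inf_a.
exists N => // n /= Nn.
have an : a n <= a N by rewrite ler_sqr ?nnegrE ?mdist_ge0//; exact: mann_fejer.
have inf_le : inf (range a) <= a n.+1 by apply: ge_inf; [exact: inf_a.2|eexists].
have step : a n.+1 <= a n - alpha n * mdist (u n) (T (u n)) ^+ 2.
  exact: mann_fixed_step.
have : c * mdist (u n) (T (u n)) ^+ 2 <= alpha n * mdist (u n) (T (u n)) ^+ 2.
  by rewrite ler_wpM2r ?sqr_ge0.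
move=> c_dist; rewrite -ler_sqr ?nnegrE ?mdist_ge0 ?(ltW e0)//.
by rewrite -(ler_pM2l c0); lra.
Qed.

(** Let p be the center of [u] and q that of a subsequence; both are fixed. The
    upper limit of d(u_n, q) equals the one along the subsequence, by
    monotonicity, which q minimizes; so it is at most the one of d(u_n, p), and
    uniqueness of the center of [u] gives q = p. *)
Lemma mann_Delta_cvg (c : R) : 0 < c -> (forall n, c <= alpha n) ->
  (exists p, T p = p) -> exists2 p, T p = p & Delta_cvg u p.
Proof.
move=> c0 c_le [p0 Tp0].
have ub := metric_bounded_seq (mann_bounded Tp0).
have u_reg := mann_asymptotic_regular Tp0 c0 c_le.
have center_fixed (f : nat -> nat) : increasing_seq f -> exists p,
    [/\ asymptotic_center (u \o f) = [set p], T p = p,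
        forall y, limsup_dist (u \o f) p <= limsup_dist (u \o f) y &
        forall q, limsup_dist (u \o f) q <= limsup_dist (u \o f) p -> q = p].
  move=> f_incr.
  have ufb := bounded_seq_comp f ub.
  have [p [pE p_min p_uniq]] := asymptotic_centerP hadX ufb.
  exists p; split=> //; apply: p_uniq.
  apply: firmly_nonspreading_limsup => // e e0.
  exact: (near_increasing_seq f_incr (u_reg e e0)).
have [p [_ Tp p_min p_uniq]] := center_fixed id (fun m n => erefl).
exists p => // f f_incr.
have [q [-> Tq q_min _]] := center_fixed f f_incr.
rewrite (p_uniq q)//.
have ufb := bounded_seq_comp f ub.
have u_le_uf : limsup_dist u q <= limsup_dist (u \o f) q.
  apply/limsup_leP => // e e0.
  have [n un] := filter_ex (limsup_near (ufb q) e0).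
  exists (f n) => // m /= nm; apply: le_trans un; exact: mann_fejer.
apply: le_trans u_le_uf (le_trans (q_min p) _).
apply/limsup_leP => // e e0.
exact: (near_increasing_seq f_incr (limsup_near (ub p) e0)).
Qed.

End mann_iteration.

(** * Resolvents of monotone operators *)

(* The sequences are indexed from 0: alpha n and x_ n stand for alpha_(n+1)
   and x_(n+1), so that the initial point is x_ 0. *)
Theorem corollary6p3 (R : realType) (X : metricType R) (A : X -> set (dual X))
    (alpha : nat -> R) (x_ : nat -> X)
    (hX : is_hadamard X)
    (A_monotone : monotone_op A)
    (A_range : range_condition A)
    (alpha01 : forall n, 0 < alpha n <= 1)
    (alpha_sum : (\sum_(0 <= n <oo) (alpha n)%:E = +oo)%E)
    (x_rec : forall n,
      x_ n.+1 = geo_comb (alpha n) (x_ n) (resolvent_map A (x_ n))) :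
  (zeros A !=set0 <-> metric_bounded (range x_)) /\
  (zeros A !=set0 -> 0 < inf (range (fun n => alpha n * (1 - alpha n))) ->
    exists2 p, zeros A p & Delta_cvg x_ p).
Proof.
have zE p := zerosE p A_monotone A_range.
have J_fns := resolvent_firmly_nonspreading A_monotone A_range.
split; first split=> [[p /zE Jp]|bounded].
- exact: mann_bounded hX J_fns alpha01 x_rec _ Jp.
- have [p /zE Ap] := mann_fixed_point hX J_fns alpha01 x_rec alpha_sum bounded.
  by exists p.
move=> [p0 /zE Jp0] inf_gt0.
have c_le n : inf (range (fun n => alpha n * (1 - alpha n))) <= alpha n.
  have /andP[an0 an1] := alpha01 n.
  apply: (@le_trans _ _ (alpha n * (1 - alpha n))); last by nra.
  apply: ge_inf; last by exists n.
  exists 0 => _ [k _ <-]; have /andP[ak0 ak1] := alpha01 k.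
  by rewrite mulr_ge0 ?subr_ge0// ltW.
have [p Jp x_p] := mann_Delta_cvg hX J_fns alpha01 x_rec inf_gt0 c_le
  (ex_intro _ p0 Jp0).
by exists p => //; apply/zE.
Qed.
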